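(* There is no absolute constant $C<\infty$ for which the following majorization statement holds for all $N\ge 1$ on the bi-tree $T^2=T_N\times T_N$: whenever $f,g:T^2\to[0,\infty)$ and $\delta>0$, $\lambda\ge 10\delta$ are such that $g$ is superadditive in each variable and $\operatorname{supp} f\subset\{\mathbb I g\le\delta\}$, there exists $\varphi:T^2\to[0,\infty)$ with (1) $\mathbb I\varphi\ge \mathbb I f$ on $\{2\lambda\le \mathbb I g\le 4\lambda\}$, and (2) $\sum_{\alpha\in T^2}\varphi(\alpha)^2\le C\,\frac{\delta}{\lambda}\sum_{\alpha\in T^2} f(\alpha)^2$. Moreover, the failure already occurs for functions of the form $f=\mathbb I^*\mu$ and $g=\mathbb I^*\nu$, where $\mu$ is the unit point mass at the root $o$ of $T^2$ (so $f(o)=1$ and $f(v)=0$ for $v\ne o$) and $\nu\ge 0$ is a measure on $T^2$ (supported on $\partial T^2$). That is, for every $C<\infty$ there exist $N$, such a $\nu$, and $\delta>0$, $\lambda\ge 10\delta$ such that $g$ is superadditive in each variable, $\operatorname{supp} f\subset\{\mathbb I g\le\delta\}$, and no $\varphi:T^2\to[0,\infty)$ satisfies both (1) and (2).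
   Context: For an integer $N\ge1$, $T=T_N$ denotes the finite rooted dyadic tree whose vertices are the dyadic subintervals of $[0,1]$ of length $2^{-k}$, $0\le k\le N$, ordered by inclusion. The bi-tree $T^2=T\times T$ has as vertices the dyadic rectangles $R=I\times J$ with $I,J\in T$, ordered by inclusion: $\alpha\le\alpha'$ iff the rectangle $\alpha$ is contained in the rectangle $\alpha'$. Its root $o$ is $[0,1]^2$, and its boundary $\partial T^2$ is the set of dyadic squares of size $2^{-N}\times2^{-N}$. For $f:T^2\to[0,\infty)$ put $\mathbb I f(\alpha)=\sum_{\alpha'\ge\alpha}f(\alpha')$ and $\mathbb I^* f(\alpha)=\sum_{\alpha'\le\alpha}f(\alpha')$. A measure on $T^2$ is a function $\nu:T^2\to[0,\infty)$ that vanishes outside $\partial T^2$. (The point mass $\mu$ at the root is the function equal to $1$ at $o$ and $0$ elsewhere.) A function $g:T\to[0,\infty)$ is superadditive if $g(I)\ge g(I_-)+g(I_+)$ for every non-leaf $I\in T$, where $I_\pm$ are the two dyadic children of $I$. A function $g:T^2\to[0,\infty)$ is superadditive in each variable if $I\mapsto g(I\times J)$ is superadditive for each fixed $J$ and $J\mapsto g(I\times J)$ is superadditive for each fixed $I$. *)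

(* Defs.v *)
From HB Require Import structures.
From mathcomp Require Import all_boot all_order all_algebra.
From mathcomp Require Import reals.

Set Implicit Arguments.
Unset Strict Implicit.
Unset Printing Implicit Defensive.

Import Order.TTheory GRing.Theory Num.Theory.
Local Open Scope ring_scope.

(* The pair (k, j), with k <= N and j < 2 ^ k, stands for the dyadic interval
   [j / 2 ^ k, (j + 1) / 2 ^ k]. *)
Definition dyadic (N : nat) : finType := {k : 'I_N.+1 & 'I_(2 ^ k)}%type.

Definition level N (I : dyadic N) : nat := tag I.
Definition position N (I : dyadic N) : nat := tagged I.

Definition lo N (I : dyadic N) : rat := (position I)%:R / 2 ^+ level I.
Definition hi N (I : dyadic N) : rat := (position I).+1%:R / 2 ^+ level I.

Definition subint N (I I' : dyadic N) : bool :=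
  (lo I' <= lo I) && (hi I <= hi I').

Definition unit_int (N : nat) : dyadic N :=
  Tagged (fun k : 'I_N.+1 => 'I_(2 ^ k))
    (Ordinal (isT : (0 < 2 ^ (@ord0 N))%N)).

(* The two halves of I; I is a leaf exactly when no such I' exists. *)
Definition left_child N (I I' : dyadic N) : bool :=
  (level I' == (level I).+1) && (position I' == (position I).*2).
Definition right_child N (I I' : dyadic N) : bool :=
  (level I' == (level I).+1) && (position I' == (position I).*2.+1).

Definition bitree (N : nat) : finType := (dyadic N * dyadic N)%type.

Definition subrect N (a a' : bitree N) : bool :=
  subint a.1 a'.1 && subint a.2 a'.2.

Definition bitree_root N : bitree N := (unit_int N, unit_int N).

Definition boundary N (a : bitree N) : bool :=
  (level a.1 == N) && (level a.2 == N).

Section Functions.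
Variables (R : realType) (N : nat).

Definition nonneg (f : bitree N -> R) : Prop := forall a, 0 <= f a.

Definition II (f : bitree N -> R) (a : bitree N) : R :=
  \sum_(a' | subrect a a') f a'.

Definition IIstar (f : bitree N -> R) (a : bitree N) : R :=
  \sum_(a' | subrect a' a) f a'.

Definition is_measure (nu : bitree N -> R) : Prop :=
  nonneg nu /\ forall a, ~~ boundary a -> nu a = 0.

Definition point_mass (a0 : bitree N) (a : bitree N) : R := (a == a0)%:R.

Definition superadditive (g : dyadic N -> R) : Prop :=
  forall I Im Ip : dyadic N,
    left_child I Im -> right_child I Ip -> g Im + g Ip <= g I.

Definition bisuperadditive (g : bitree N -> R) : Prop :=
  (forall J, superadditive (fun I => g (I, J))) /\
  (forall I, superadditive (fun J => g (I, J))).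

End Functions.

(* Main.v *)
Require Import Defs.
From mathcomp Require Import all_boot all_order all_algebra.
From mathcomp Require Import reals.
From mathcomp Require Import ring lra.

Set Implicit Arguments.
Unset Strict Implicit.
Unset Printing Implicit Defensive.

Import Order.TTheory GRing.Theory Num.Theory.
Local Open Scope ring_scope.

(** The measure nu is a unit point mass in one corner cell x of the square, and
delta = 1.  Then II g at a counts the rectangles that contain both a and x, so
at the root it equals 1, while at the rectangle [0, 2 ^ -i] x [0, 2 ^ -j] it
equals (i + 1) (j + 1).  On a tree a point mass produces one chain of intervals
at which its potential is large; on the bi-tree the level set
(i + 1) (j + 1) = 2 lambda is a hyperbola, and it contains many rectangles that
are almost independent of each other.

Precisely, take 2 lambda = 2 ^ n and the n + 1 rectangles a_k with
i + 1 = 2 ^ k, j + 1 = 2 ^ (n - k).  The number of common ancestors of a_k and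
a_l is 2 ^ (n - |k - l|) ([common_ancestors_hyperbola]), so the sum of these
numbers over all pairs is at most 4 (n + 1) 2 ^ n: up to a constant, only the
diagonal pairs count.  Since II f = 1 everywhere, an admissible phi has
II phi >= 1 at every a_k, and the dual description of capacity
([capacity_lower_bound]: test phi against the sum of the point masses at the
a_k) gives a squared norm of at least (n + 1) ^ 2 / (4 (n + 1) 2 ^ n)
([hyperbola_capacity]).  This exceeds delta / lambda = 2 / 2 ^ n by the
unbounded factor (n + 1) / 8. *)

(** * Rectangles in the corner of the square *)

Definition corner N (i : 'I_N.+1) : dyadic N :=
  Tagged (fun k : 'I_N.+1 => 'I_(2 ^ k)) (Ordinal (expn_gt0 2 i : (0 < 2 ^ i)%N)).

Definition corner_rect N (i j : 'I_N.+1) : bitree N := (corner i, corner j).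

(** The reproducing kernel of the bi-tree: the potential at [a] of a unit mass
at [b]. *)
Definition common_ancestors N (a b : bitree N) : nat :=
  #|[pred c | subrect a c && subrect b c]|.

Lemma corner_inj N : injective (@corner N).
Proof. by move=> i j /(congr1 (fun I : dyadic N => tag I)). Qed.

Lemma corner_tagE N (I : dyadic N) : (corner (tag I) == I) = (position I == 0%N).
Proof.
apply/eqP/eqP => [<- //|]; case: I => i p /= p0.
by congr existT; apply: val_inj.
Qed.

(** The intervals above [0, 2 ^ -i] form the chain of intervals with left
endpoint 0 and level at most i. *)
Lemma subint_corner N (i : 'I_N.+1) (I : dyadic N) :
  subint (corner i) I = (position I == 0%N) && (level I <= i)%N.
Proof.
rewrite /subint /lo /hi {2}/position /= mul0r.
have p2 (k : nat) : (0 : rat) < 2 ^+ k by rewrite exprn_gt0.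
rewrite pmulr_lle0 ?invr_gt0 // lern0.
case: eqP => //= ->.
rewrite !div1r lef_pV2 ?posrE //.
by rewrite ler_eXn2l.
Qed.

Lemma card_corner_ancestors N (i j : 'I_N.+1) :
  #|[pred I | subint (corner i) I && subint (corner j) I]| = (minn i j).+1.
Proof.
have le_m : ((minn i j).+1 <= N.+1)%N by rewrite ltnS geq_min leq_ord.
have <- : #|[pred l : 'I_N.+1 | (l < (minn i j).+1)%N]| = (minn i j).+1.
  by rewrite -sum1_card (big_ord_narrow le_m) sum1_card card_ord.
rewrite -(card_image (@corner_inj N)); apply: eq_card => I.
rewrite !inE !subint_corner; apply/idP/imageP => [|[l + ->]].
  case/andP=> /andP[p0 Ii] /andP[_ Ij]; exists (tag I).
    by rewrite inE ltnS leq_min Ii.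
  by apply/esym/eqP; rewrite corner_tagE.
by rewrite inE ltnS leq_min => /andP[-> ->].
Qed.

(** Ancestors of a rectangle are chosen independently in the two variables; this
product is what bends the level sets of the potential into hyperbolas. *)
Lemma common_ancestors_corner N (i j i' j' : 'I_N.+1) :
  common_ancestors (corner_rect i j) (corner_rect i' j')
    = ((minn i i').+1 * (minn j j').+1)%N.
Proof.
rewrite -!card_corner_ancestors -cardX; apply: eq_card => -[I J].
by rewrite !inE /subrect /= andbACA.
Qed.

Lemma unit_intE N : unit_int N = corner ord0.
Proof. by apply/eqP; rewrite eq_sym (corner_tagE (unit_int N)). Qed.

Lemma subint_unit N (I : dyadic N) : subint I (unit_int N).
Proof.
rewrite /subint.
have -> : lo (unit_int N) = 0 by rewrite /lo mul0r.
have -> : hi (unit_int N) = 1 by rewrite /hi divr1.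
have p2 : (0 : rat) < 2 ^+ level I by rewrite exprn_gt0.
rewrite /lo /hi divr_ge0 ?ler0n ?(ltW p2) //= ler_pdivrMr // mul1r -natrX ler_nat.
exact: ltn_ord.
Qed.

Lemma subrect_root N (a : bitree N) :
  subrect (bitree_root N) a = (a == bitree_root N).
Proof.
have sub_unit (I : dyadic N) : subint (unit_int N) I = (I == unit_int N).
  rewrite unit_intE subint_corner leqn0.
  apply/andP/eqP => [[p0 /eqP l0]|-> //].
  by move: p0; rewrite -corner_tagE => /eqP <-; congr corner; apply: val_inj.
by case: a => I J; rewrite /subrect !sub_unit xpair_eqE.
Qed.

Lemma common_ancestors_root N (a : bitree N) :
  common_ancestors a (bitree_root N) = 1%N.
Proof.
rewrite -(card1 (bitree_root N)); apply: eq_card => c.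
rewrite !inE subrect_root andb_idl // => /eqP ->.
by case: a => I J; apply/andP; split; apply: subint_unit.
Qed.

(** * Potentials and capacity *)

Section Capacity.
Variables (R : realType) (N : nat).

Lemma IIstar_point_mass (b a : bitree N) :
  IIstar (point_mass R b) a = (subrect b a)%:R.
Proof.
rewrite /IIstar /point_mass.
by rewrite (big_mkcond (fun _ => _)) (bigD1 b) //= big1 ?addr0 ?eqxx
   => [|c /negPf->]; case: ifP.
Qed.

Lemma II_IIstar_point_mass (b a : bitree N) :
  II (IIstar (point_mass R b)) a = (common_ancestors a b)%:R.
Proof.
rewrite /II (eq_bigr _ (fun c _ => IIstar_point_mass b c)).
by rewrite -natr_sum -big_mkcondr /= sum1_card.
Qed.

(** Of the two halves of an interval, only the left one can have left
endpoint 0, and it does so only if the interval does. *)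
Lemma IIstar_corner_superadditive :
  bisuperadditive
    (IIstar (point_mass R (corner_rect ord_max ord_max : bitree N))).
Proof.
have sub (I : dyadic N) : subint (corner ord_max) I = (position I == 0%N).
  by rewrite subint_corner andb_idr //= => _; rewrite -ltnS ltn_ord.
split=> [J|J] I Im Ip /andP[_ /eqP pm] /andP[_ /eqP pp];
  rewrite !IIstar_point_mass /subrect /= !sub pm pp double_eq0 ?andbF addr0 //.
Qed.

(** Let m be [IIstar] of the sum of the unit masses at the [a s].  Its squared
norm is the energy bounded by [E], and its pairing with phi is the sum of the
[II phi (a s)], hence at least [#|T|]; the Cauchy-Schwarz inequality concludes.
*)
Lemma capacity_lower_bound (T : finType) (a : T -> bitree N) (E : R)
    (phi : bitree N -> R) :
  0 < E -> (\sum_s \sum_t common_ancestors (a s) (a t))%N%:R <= E ->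
  (forall s, 1 <= II phi (a s)) ->
  #|T|%:R ^+ 2 / E <= \sum_c phi c ^+ 2.
Proof.
move=> E0 leE phi1; set n : R := #|T|%:R.
pose m c : R := \sum_s (subrect (a s) c)%:R.
have phim : n <= \sum_c phi c * m c.
  rewrite /n -sum1_card natr_sum.
  under [leRHS]eq_bigr => c _ do rewrite mulr_sumr.
  rewrite exchange_big /=; apply: ler_sum => s _.
  apply: le_trans (phi1 s) _; rewrite /II big_mkcond /=.
  by apply: ler_sum => c _; case: ifP; rewrite (mulr1, mulr0).
have mm : \sum_c m c ^+ 2 <= E.
  apply: le_trans leE; rewrite natr_sum.
  under [leLHS]eq_bigr => c _ do rewrite expr2 mulr_suml.
  rewrite exchange_big /=; apply: ler_sum => s _; rewrite natr_sum.
  under [leLHS]eq_bigr => c _ do rewrite mulr_sumr.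
  rewrite exchange_big /=; apply: ler_sum => t _.
  rewrite /common_ancestors -sum1_card natr_sum [leRHS]big_mkcond /=.
  by apply: ler_sum => c _; rewrite inE -natrM mulnb; case: (_ && _).
have n0 : 0 <= n by rewrite ler0n.
have t0 : 0 <= n / E by rewrite divr_ge0 // ltW.
(* The multiple of m that best approximates an extremal phi: expanding this
   square is the Cauchy-Schwarz inequality without a square root. *)
have : 0 <= \sum_c (phi c - (n / E) * m c) ^+ 2.
  by apply: sumr_ge0 => c _; rewrite sqr_ge0.
have -> : \sum_c (phi c - (n / E) * m c) ^+ 2 =
   \sum_c phi c ^+ 2 - 2 * (n / E) * (\sum_c phi c * m c)
     + (n / E) ^+ 2 * \sum_c m c ^+ 2.
  rewrite !mulr_sumr -sumrB -big_split /=.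
  by apply: eq_bigr => c _; ring.
have h1 : n / E * n <= n / E * \sum_c phi c * m c by rewrite ler_wpM2l.
have h2 : (n / E) ^+ 2 * \sum_c m c ^+ 2 <= (n / E) ^+ 2 * E.
  by rewrite ler_wpM2l // sqr_ge0.
have -> : n ^+ 2 / E = n / E * n by ring.
have e3 : (n / E) ^+ 2 * E = n / E * n by field; rewrite gt_eqF.
by rewrite e3 in h2; lra.
Qed.

End Capacity.

(** * The rectangles along a hyperbola *)

Lemma sum_pow2_le (n k : nat) : (k <= n)%N ->
  (\sum_(l < n.+1 | l <= k) 2 ^ l <= 2 ^ k.+1)%N.
Proof.
rewrite -ltnS => kn; rewrite (big_ord_narrow (F := fun l => 2 ^ l)%N kn) /=.
by have := predn_exp 2 k.+1; rewrite mul1n => <-; rewrite leq_pred.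
Qed.

(** The l-th term is 2 ^ (n - |k - l|), so each side of the diagonal
contributes a geometric sum of at most 2 * 2 ^ n; the reflection l -> n - l
exchanges the two sides.  The diagonal term is counted on both. *)
Lemma hyperbola_row_sum (n k : nat) : (k <= n)%N ->
  (\sum_(l < n.+1) 2 ^ minn k l * 2 ^ minn (n - k) (n - l) <= 4 * 2 ^ n)%N.
Proof.
move=> kn.
have le_l (l : 'I_n.+1) : (l <= n)%N by rewrite -ltnS.
apply: (@leq_trans (\sum_(l < n.+1 | l <= k) 2 ^ l * 2 ^ (n - k)
   + \sum_(l < n.+1 | n - l <= n - k) 2 ^ k * 2 ^ (n - l))%N).
  rewrite [X in (_ <= X + _)%N]big_mkcond [X in (_ <= _ + X)%N]big_mkcond /=.
  rewrite -big_split /=; apply: leq_sum => l _.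
  case: (leqP l k) => [lk|/ltnW kl].
    by rewrite (minn_idPl (leq_sub2l n lk)) leq_addr.
  by rewrite leq_sub2l // (minn_idPr (leq_sub2l n kl)).
rewrite -big_distrl -big_distrr /=.
rewrite [X in (_ + _ * X)%N](reindex_inj rev_ord_inj) /=.
under [X in (_ + _ * X)%N]eq_bigl => l do rewrite subSS subKn //.
under [X in (_ + _ * X)%N]eq_bigr => l _ do rewrite subSS subKn //.
have := sum_pow2_le kn; have := sum_pow2_le (leq_subr k n).
have -> : (2 ^ n = 2 ^ k * 2 ^ (n - k))%N by rewrite -expnD subnKC.
rewrite !expnS => sum_right sum_left.
rewrite -[4%N]/(2 + 2)%N mulnDl leq_add //;
  first by rewrite mulnA leq_mul2r sum_left orbT.
by rewrite mulnCA leq_mul2l sum_right orbT.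
Qed.

(** An interval of level 2 ^ k - 1 has 2 ^ k ancestors, itself included; so the
rectangle below has 2 ^ k * 2 ^ (n - k) = 2 ^ n ancestors for every k. *)
Definition hyperbola_rect n (k : 'I_n.+1) : bitree (2 ^ n) :=
  corner_rect (inord (2 ^ k).-1) (inord (2 ^ (n - k)).-1).

Lemma inord_pow2 n (k : nat) : (k <= n)%N ->
  (inord (2 ^ k).-1 : 'I_(2 ^ n).+1) = (2 ^ k).-1 :> nat.
Proof.
by move=> kn; rewrite inordK // ltnS (leq_trans (leq_pred _)) // leq_exp2l.
Qed.

Lemma common_ancestors_hyperbola n (k l : 'I_n.+1) :
  common_ancestors (hyperbola_rect k) (hyperbola_rect l)
    = (2 ^ minn k l * 2 ^ minn (n - k) (n - l))%N.
Proof.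
have minS (i j : nat) : (minn (2 ^ i).-1 (2 ^ j).-1).+1 = (2 ^ minn i j)%N.
  rewrite -minnSS !prednK ?expn_gt0 //.
  by case: (leqP i j) => ij; [rewrite (minn_idPl _)|rewrite (minn_idPr _)];
     rewrite // leq_exp2l // ltnW.
rewrite common_ancestors_corner !inord_pow2 ?leq_subr -1?ltnS ?ltn_ord //.
by rewrite !minS.
Qed.

Lemma common_ancestors_hyperbola_corner n (k : 'I_n.+1) :
  common_ancestors (hyperbola_rect k) (corner_rect ord_max ord_max) = (2 ^ n)%N.
Proof.
have kn : (k <= n)%N by rewrite -ltnS.
rewrite common_ancestors_corner !(minn_idPl (leq_ord _)).
rewrite !inord_pow2 ?leq_subr // !prednK ?expn_gt0 //.
by rewrite -expnD subnKC.
Qed.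

Lemma hyperbola_capacity (R : realType) n (phi : bitree (2 ^ n) -> R) :
  (forall k, 1 <= II phi (@hyperbola_rect n k)) ->
  n.+1%:R / (4 * 2 ^+ n) <= \sum_c phi c ^+ 2.
Proof.
move=> phi1; have p2 : (0 : R) < 2 ^+ n by rewrite exprn_gt0.
have n0 : (0 : R) < n.+1%:R by rewrite ltr0n.
have -> : n.+1%:R / (4 * 2 ^+ n) = #|'I_n.+1|%:R ^+ 2 / (n.+1%:R * (4 * 2 ^+ n)) :> R.
  rewrite card_ord; move: (n.+1%:R : R) (2 ^+ n : R) n0 p2 => m p m0 p0.
  by field; rewrite !gt_eqF.
apply: (capacity_lower_bound (a := @hyperbola_rect n)) phi1.
  by rewrite !mulr_gt0.
rewrite -natrX -!natrM ler_nat -[X in (_ <= X * _)%N](card_ord n.+1) -sum_nat_const.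
apply: leq_sum => k _.
under eq_bigr => l _ do rewrite common_ancestors_hyperbola.
by apply: hyperbola_row_sum; rewrite -ltnS.
Qed.

Theorem mainTheorem1 (R : realType) :
  (~ exists C : R,
      forall N : nat, (1 <= N)%N ->
      forall (f g : bitree N -> R) (delta lambda : R),
        nonneg f -> nonneg g ->
        0 < delta -> 10 * delta <= lambda ->
        bisuperadditive g ->
        (forall a, f a != 0 -> II g a <= delta) ->
        exists phi : bitree N -> R,
          nonneg phi /\
          (forall a, 2 * lambda <= II g a -> II g a <= 4 * lambda ->
             II f a <= II phi a) /\
          \sum_a phi a ^+ 2 <= C * (delta / lambda) * \sum_a f a ^+ 2)
  /\
  (forall C : R,
    exists (N : nat) (nu : bitree N -> R) (delta lambda : R),
      let f : bitree N -> R := IIstar (point_mass R (bitree_root N)) in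
      let g : bitree N -> R := IIstar nu in
      (1 <= N)%N /\
      is_measure nu /\
      (f (bitree_root N) = 1 /\ forall v, v != bitree_root N -> f v = 0) /\
      0 < delta /\ 10 * delta <= lambda /\
      bisuperadditive g /\
      (forall a, f a != 0 -> II g a <= delta) /\
      ~ exists phi : bitree N -> R,
          nonneg phi /\
          (forall a, 2 * lambda <= II g a -> II g a <= 4 * lambda ->
             II f a <= II phi a) /\
          \sum_a phi a ^+ 2 <= C * (delta / lambda) * \sum_a f a ^+ 2).
Proof.
(* The first claim follows from the second, with the same C. *)
have and_from_right (A B : Prop) : (B -> A) -> B -> A /\ B by split; auto.
apply: and_from_right => [counterexample [C majorization] | C].
  have [N [nu [delta [lambda [N1 [nu_meas [_ [d0 [dl [g_super [f_supp no_phi]]]]]]]]]]] :=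
    counterexample C.
  apply: no_phi; apply: majorization => // a; apply: sumr_ge0 => b _.
    by rewrite ler0n.
  exact: nu_meas.1.
(* n >= 5 gives lambda = 2 ^ n / 2 >= 16 >= 10 delta. *)
have [n [n5 Cn]] : exists n, (5 <= n)%N /\ 8 * C < n.+1%:R.
  exists (maxn 5 (Num.bound `|8 * C|)); split; first exact: leq_maxl.
  apply: le_lt_trans (ler_norm _) _.
  apply: lt_le_trans (archi_boundP (normr_ge0 _)) _.
  by rewrite ler_nat leqW // leq_maxr.
pose x : bitree (2 ^ n) := corner_rect ord_max ord_max.
have p2 : (0 : R) < 2 ^+ n by rewrite exprn_gt0.
(* The depth 2 ^ n leaves room for the levels 2 ^ k - 1 with k <= n. *)
exists (2 ^ n)%N, (point_mass R x), 1, (2 ^+ n / 2) => f g.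
have fE a : f a = (a == bitree_root (2 ^ n))%:R.
  by rewrite /f IIstar_point_mass subrect_root.
split; first by rewrite expn_gt0.
split.
  split=> [a|a nba]; rewrite /point_mass ?ler0n //.
  by case: eqP nba => // ->; rewrite /boundary /= /level /= eqxx.
split; first by split=> [|v /negPf v0]; rewrite fE ?eqxx // v0.
split; first exact: ltr01.
split.
  have : 32%:R <= (2 ^ n)%:R :> R by rewrite ler_nat (@leq_exp2l 2 5 n).
  by rewrite natrX; lra.
split; first exact: IIstar_corner_superadditive.
split.
  move=> a; rewrite fE; case: (eqVneq a (bitree_root (2 ^ n))) => [-> _|_];
    last by rewrite eqxx.
  rewrite II_IIstar_point_mass /bitree_root unit_intE.
  by rewrite common_ancestors_corner !min0n.
case=> phi [_ [major small]].
have IIf a : II f a = 1.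
  by rewrite II_IIstar_point_mass common_ancestors_root.
have f2 : \sum_a f a ^+ 2 = 1.
  rewrite (bigD1 (bitree_root (2 ^ n))) //= fE eqxx expr1n big1 ?addr0 // => a.
  by move=> /negPf a0; rewrite fE a0 expr0n.
have phi1 k : 1 <= II phi (@hyperbola_rect n k).
  have gk : II g (@hyperbola_rect n k) = 2 ^+ n.
    by rewrite II_IIstar_point_mass common_ancestors_hyperbola_corner natrX.
  by rewrite -(IIf (hyperbola_rect k)); apply: major; rewrite gk; lra.
have := le_trans (hyperbola_capacity phi1) small.
rewrite f2 mulr1 ler_pdivrMr ?mulr_gt0 //.
have -> : C * (1 / (2 ^+ n / 2)) * (4 * 2 ^+ n) = 8 * C.
  by field; rewrite gt_eqF.
by rewrite leNgt Cn.
Qed.
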